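(* Let $S$ be an admissible surface in the simply isotropic space $\mathbb{I}^3$ with local parameterization $\mathbf{x}(u^1,u^2)$, and let $$\mathcal{R}_{ijk}^{\ell}=\Xi_{ij,k}^{\ell}-\Xi_{ik,j}^{\ell}+\Xi_{ij}^s\Xi_{ks}^{\ell}-\Xi_{ik}^s\Xi_{js}^{\ell},\qquad \mathcal{R}_{dabc}=g_{ed}\mathcal{R}_{abc}^e$$ be the curvature tensor of the relative connection. Then $$\mathcal{R}_{dabc}=\frac{h_{ab}h_{cd}-h_{ac}h_{bd}}{\Vert\tilde\xi\Vert^2+\xi^3},$$ and the relative Gaussian curvature $K$ of $S$ satisfies $$K=(\Vert\tilde\xi\Vert^2+\xi^3)\,\frac{\mathcal{R}_{2112}}{g_{11}g_{22}-(g_{12})^2}=\frac{\Vert\tilde\xi\Vert^2+\xi^3}{g_{11}}\left(\Xi_{11,2}^2-\Xi_{12,1}^2+\Xi_{11}^\ell\Xi_{\ell2}^2-\Xi_{12}^\ell\Xi_{\ell1}^2\right).$$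
   Context: The simply isotropic space $\mathbb{I}^3$ is $\mathbb{R}^3$ with the degenerate inner product $\langle \mathbf u,\mathbf v\rangle_z=u^1v^1+u^2v^2$. A plane is isotropic if it contains a line parallel to the $z$-axis; a smooth surface is admissible if none of its tangent planes is isotropic. Write $\mathbf{x}_i=\partial\mathbf{x}/\partial u^i=(x_i^1,x_i^2,x_i^3)$, $\mathbf{x}_{ij}=\partial^2\mathbf{x}/\partial u^i\partial u^j$, $X_{ij}=x_1^ix_2^j-x_1^jx_2^i$ (so $X_{12}\neq0$), $g_{ij}=\langle\mathbf{x}_i,\mathbf{x}_j\rangle_z$. A comma followed by an index $k$ denotes $\partial/\partial u^k$; repeated indices are summed over $\{1,2\}$. The isotropic Gauss map is $$\xi=(\xi^1,\xi^2,\xi^3)=\left(\frac{X_{23}}{X_{12}},\ \frac{X_{31}}{X_{12}},\ \frac12\left\{1-\left[\left(\frac{X_{23}}{X_{12}}\right)^2+\left(\frac{X_{31}}{X_{12}}\right)^2\right]\right\}\right),$$ and $\tilde\xi=(\xi^1,\xi^2,0)$, with Euclidean norm $\Vert\tilde\xi\Vert$. One has $\Vert\tilde\xi\Vert^2+\xi^3>0$ and $\{\mathbf{x}_1,\mathbf{x}_2,\xi\}$ is a basis of $\mathbb{R}^3$. The relative connection coefficients $\Xi_{ij}^k$ and the coefficients $\rho_{ij}$ are defined by $\mathbf{x}_{ij}=\Xi_{ij}^k\mathbf{x}_k+\rho_{ij}\,\xi$. The isotropic shape operator is the linear operator on $T_qS$ with $L_q(\mathbf{x}_i)=-\partial\xi/\partial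 u^i$. The second fundamental form coefficients are $h_{ij}=\langle L_q(\mathbf{x}_i),\mathbf{x}_j\rangle_z=\det(\mathbf{x}_1,\mathbf{x}_2,\mathbf{x}_{ij})/X_{12}$. The relative (isotropic) Gaussian curvature is $K=\det L_q$. *)

(* Defs.v *)
From Stdlib Require Import Reals ClassicalEpsilon.
From Coquelicot Require Import Coquelicot.
Open Scope R_scope.

Definition vec3 : Type := (R * R * R)%type.

Inductive coord : Set := C1 | C2 | C3.

Definition co (a : coord) (v : vec3) : R :=
  match a with
  | C1 => fst (fst v)
  | C2 => snd (fst v)
  | C3 => snd v
  end.

Definition e_z : vec3 := (0, 0, 1).

Definition inner_z (v w : vec3) : R := co C1 v * co C1 w + co C2 v * co C2 w.

(** Indices of the surface parameters [u^1], [u^2]; repeated indices in the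
    classical formulas are rendered by [sum2]. *)
Inductive index : Set := I1 | I2.

Definition sum2 (f : index -> R) : R := f I1 + f I2.

Definition pd (k : index) (f : R * R -> R) (p : R * R) : R :=
  match k with
  | I1 => Derive (fun t => f (t, snd p)) (fst p)
  | I2 => Derive (fun t => f (fst p, t)) (snd p)
  end.

Definition vpd (k : index) (y : R * R -> vec3) (p : R * R) : vec3 :=
  (pd k (fun q => co C1 (y q)) p,
   pd k (fun q => co C2 (y q)) p,
   pd k (fun q => co C3 (y q)) p).

(** [ex_diff_n f n] states that all iterated partial derivatives of [f] up to
    order [n] exist and are continuous at the given point. *)
Definition smooth_on (U : R * R -> Prop) (y : R * R -> vec3) : Prop :=
  forall (a : coord) (n : nat) (p : R * R), U p ->
    ex_diff_n (fun s t => co a (y (s, t))) n (fst p) (snd p).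

Definition lin_indep2 (v w : vec3) : Prop :=
  forall a b : R, plus (scal a v) (scal b w) = zero -> a = 0 /\ b = 0.

Definition local_parameterization (U : R * R -> Prop) (x : R * R -> vec3)
  : Prop :=
  open U /\ smooth_on U x /\
  forall p, U p -> lin_indep2 (vpd I1 x p) (vpd I2 x p).

(** The affine tangent plane at [x p], as a set of points. *)
Definition tangent_plane (x : R * R -> vec3) (p : R * R) (q : vec3) : Prop :=
  exists a b : R,
    q = plus (x p) (plus (scal a (vpd I1 x p)) (scal b (vpd I2 x p))).

Definition isotropic_plane (P : vec3 -> Prop) : Prop :=
  exists q : vec3, forall t : R, P (plus q (scal t e_z)).

Definition admissible (U : R * R -> Prop) (x : R * R -> vec3) : Prop :=
  forall p, U p -> ~ isotropic_plane (tangent_plane x p).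

Definition X (x : R * R -> vec3) (a b : coord) (p : R * R) : R :=
  co a (vpd I1 x p) * co b (vpd I2 x p) - co b (vpd I1 x p) * co a (vpd I2 x p).

Definition g (x : R * R -> vec3) (i j : index) (p : R * R) : R :=
  inner_z (vpd i x p) (vpd j x p).

Definition xi (x : R * R -> vec3) (p : R * R) : vec3 :=
  (X x C2 C3 p / X x C1 C2 p,
   X x C3 C1 p / X x C1 C2 p,
   1 / 2 * (1 - ((X x C2 C3 p / X x C1 C2 p) ^ 2
                 + (X x C3 C1 p / X x C1 C2 p) ^ 2))).

Definition xi_tilde (x : R * R -> vec3) (p : R * R) : vec3 :=
  (co C1 (xi x p), co C2 (xi x p), 0).

(** [norm] on a product of normed modules is the square root of the sum of the
    squared norms, so on [vec3] it is the Euclidean norm. *)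
Definition xi_factor (x : R * R -> vec3) (p : R * R) : R :=
  norm (xi_tilde x p) ^ 2 + co C3 (xi x p).

(** Coefficients [(c1, c2, c3)] with [v = c1 x_1 + c2 x_2 + c3 xi].  They exist
    and are unique since [x_1, x_2, xi] is a basis. *)
Definition frame_coeffs (x : R * R -> vec3) (p : R * R) (v : vec3)
  : R * R * R :=
  epsilon (inhabits (0, 0, 0)) (fun c =>
    v = plus (plus (scal (fst (fst c)) (vpd I1 x p))
                   (scal (snd (fst c)) (vpd I2 x p)))
             (scal (snd c) (xi x p))).

(** [Xi x i j k] is the connection coefficient with lower indices [i j] and upper
    index [k]: [x_ij = Xi_ij^k x_k + rho_ij xi]. *)
Definition Xi (x : R * R -> vec3) (i j k : index) (p : R * R) : R :=
  let c := frame_coeffs x p (vpd i (vpd j x) p) in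
  match k with I1 => fst (fst c) | I2 => snd (fst c) end.

(** Coefficients [(c1, c2)] with [v = c1 x_1 + c2 x_2], for [v] in the linear
    tangent plane. *)
Definition tangent_coeffs (x : R * R -> vec3) (p : R * R) (v : vec3) : R * R :=
  epsilon (inhabits (0, 0)) (fun c =>
    v = plus (scal (fst c) (vpd I1 x p)) (scal (snd c) (vpd I2 x p))).

Definition tangent_coeff (x : R * R -> vec3) (p : R * R) (v : vec3)
  (k : index) : R :=
  match k with
  | I1 => fst (tangent_coeffs x p v)
  | I2 => snd (tangent_coeffs x p v)
  end.

(** The linear operator on the tangent plane with [L (x_i) = - d xi / d u^i];
    its values off the tangent plane carry no meaning. *)
Definition shape_operator (x : R * R -> vec3) (p : R * R) (v : vec3) : vec3 :=
  plus (scal (tangent_coeff x p v I1) (opp (vpd I1 (xi x) p)))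
       (scal (tangent_coeff x p v I2) (opp (vpd I2 (xi x) p))).

Definition h (x : R * R -> vec3) (i j : index) (p : R * R) : R :=
  inner_z (shape_operator x p (vpd i x p)) (vpd j x p).

(** The matrix of the shape operator in the basis [x_1, x_2] of the tangent
    plane: [L (x_i) = L_i^k x_k]. *)
Definition L_matrix (x : R * R -> vec3) (i k : index) (p : R * R) : R :=
  tangent_coeff x p (shape_operator x p (vpd i x p)) k.

Definition K (x : R * R -> vec3) (p : R * R) : R :=
  L_matrix x I1 I1 p * L_matrix x I2 I2 p
  - L_matrix x I1 I2 p * L_matrix x I2 I1 p.

(** [Riem x l i j k] has upper index [l] and lower indices [i j k]. *)
Definition Riem (x : R * R -> vec3) (l i j k : index) (p : R * R) : R :=
  pd k (Xi x i j l) p - pd j (Xi x i k l) p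
  + sum2 (fun s => Xi x i j s p * Xi x k s l p)
  - sum2 (fun s => Xi x i k s p * Xi x j s l p).

Definition Riem_low (x : R * R -> vec3) (d a b c : index) (p : R * R) : R :=
  sum2 (fun e => g x e d p * Riem x e a b c p).

(* Main.v *)
From Stdlib Require Import Reals ClassicalEpsilon Lra.
From Coquelicot Require Import Coquelicot.
Require Import Defs.
Open Scope R_scope.

(** The proof is the classical compatibility argument for a frame
    [x_1, x_2, xi] that varies along the surface.  Two structure equations
    govern it: [x_ij = Xi_ij^l x_l + rho_ij xi] ([gauss_formula]) and
    [xi_k = - L_k^l x_l] ([weingarten_formula]).  Differentiate the first in
    [u^k], substitute both equations into the result, and use that third
    derivatives commute.  Comparing the coefficients of [x_l] in the frame gives
      [R_ijk^l = rho_ij L_k^l - rho_ik L_j^l]   ([gauss_equation]).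

    Everything else relates [rho], [h] and [L] through the covector
    [N = (xi^1, xi^2, 1)] ([conormal]).  It annihilates [x_1] and [x_2], and
    [N(xi)] is the factor [F = |xi~|^2 + xi^3 = (1 + (xi^1)^2 + (xi^2)^2) / 2 > 0].
    Hence the frame is a basis and [rho_ij = N(x_ij) / F]; differentiating
    [N(x_j) = 0] gives [h_ij = N(x_ij) = F rho_ij] ([h_eq_rho]).  As
    [N(xi_k) = 0] too, the shape operator maps into the tangent plane and
    [h_ij = L_i^l g_lj] ([h_eq_L]).  Lowering the index in the Gauss equation
    then yields [F R_dabc = h_ab h_cd - h_ac h_bd], and the two formulas for [K]
    follow from [h = L g] and the symmetry of [h].

    The connection coefficients and the matrix of [L] come from a choice
    operator, so they are first identified with explicit Cramer quotients
    ([Xi_eq], [tangent_coeff_eq]).  This is what makes the coefficients of the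
    connection differentiable.  Those formulas hold only on the open set [U],
    hence derivatives are compared through [is_pd_ext_on] and [pd_ext_on]. *)

(** * Calculus of partial derivatives *)

Definition slice (k : index) (p : R * R) (t : R) : R * R :=
  match k with I1 => (t, snd p) | I2 => (fst p, t) end.

Definition param (k : index) (p : R * R) : R :=
  match k with I1 => fst p | I2 => snd p end.

Definition is_pd (k : index) (f : R * R -> R) (p : R * R) (l : R) : Prop :=
  is_derive (fun t => f (slice k p t)) (param k p) l.

(** Existence of both partial derivatives at every point of [U], in the form in
    which it is used: the total operator [pd] returns an actual derivative. *)
Definition pdiff_on (U : R * R -> Prop) (f : R * R -> R) : Prop :=
  forall k p, U p -> is_pd k f p (pd k f p).

Lemma slice_param (k : index) (p : R * R) : slice k p (param k p) = p.
Proof. now destruct p, k. Qed.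

Lemma is_pd_unique (k : index) (f : R * R -> R) (p : R * R) (l : R) :
  is_pd k f p l -> pd k f p = l.
Proof. intros H; destruct k; exact (is_derive_unique _ _ _ H). Qed.

Lemma is_pd_pdiff (U : R * R -> Prop) (f : R * R -> R) :
  (forall k p, U p -> exists l, is_pd k f p l) -> pdiff_on U f.
Proof.
intros H k p hp; destruct (H k p hp) as [l Hl].
now rewrite (is_pd_unique _ _ _ _ Hl).
Qed.

Lemma is_pd_plus (k : index) (f1 f2 : R * R -> R) (p : R * R) (l1 l2 : R) :
  is_pd k f1 p l1 -> is_pd k f2 p l2 ->
  is_pd k (fun q => f1 q + f2 q) p (l1 + l2).
Proof. intros H1 H2; exact (is_derive_plus _ _ _ _ _ H1 H2). Qed.

Lemma is_pd_minus (k : index) (f1 f2 : R * R -> R) (p : R * R) (l1 l2 : R) :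
  is_pd k f1 p l1 -> is_pd k f2 p l2 ->
  is_pd k (fun q => f1 q - f2 q) p (l1 - l2).
Proof. intros H1 H2; exact (is_derive_minus _ _ _ _ _ H1 H2). Qed.

Lemma is_pd_mult (k : index) (f1 f2 : R * R -> R) (p : R * R) (l1 l2 : R) :
  is_pd k f1 p l1 -> is_pd k f2 p l2 ->
  is_pd k (fun q => f1 q * f2 q) p (l1 * f2 p + f1 p * l2).
Proof.
intros H1 H2.
generalize (is_derive_mult _ _ _ _ _ H1 H2 Rmult_comm).
now rewrite slice_param.
Qed.

Lemma is_pd_const (k : index) (c : R) (p : R * R) : is_pd k (fun _ => c) p 0.
Proof. exact (is_derive_const (V := R_NormedModule) c (param k p)). Qed.

Lemma is_pd_div (k : index) (f1 f2 : R * R -> R) (p : R * R) (l1 l2 : R) :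
  f2 p <> 0 -> is_pd k f1 p l1 -> is_pd k f2 p l2 ->
  is_pd k (fun q => f1 q / f2 q) p ((l1 * f2 p - f1 p * l2) / f2 p ^ 2).
Proof.
intros H0 H1 H2; rewrite <- (slice_param k p) in H0.
generalize (is_derive_div _ _ _ _ _ H1 H2 H0).
now rewrite slice_param.
Qed.

Section PartialDerivatives.

Context (U : R * R -> Prop) (hU : open U).

(** An open set meets each coordinate line in an open set, so an identity valid
    on [U] may be differentiated. *)
Lemma locally_slice (k : index) (p : R * R) :
  U p -> locally (param k p) (fun t => U (slice k p t)).
Proof.
intros hp; destruct (hU p hp) as [e He]; exists e; intros t Ht; apply He.
destruct p, k; split; try exact Ht; apply ball_center.
Qed.

Lemma is_pd_ext_on (k : index) (f1 f2 : R * R -> R) (p : R * R) (l : R) :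
  U p -> (forall q, U q -> f1 q = f2 q) -> is_pd k f1 p l -> is_pd k f2 p l.
Proof.
intros hp Hf; apply is_derive_ext_loc.
apply (filter_imp (fun t => U (slice k p t)));
  [intros t Ht | exact (locally_slice k p hp)]; now apply Hf.
Qed.

Lemma pd_ext_on (k : index) (f1 f2 : R * R -> R) (p : R * R) :
  U p -> (forall q, U q -> f1 q = f2 q) -> pd k f1 p = pd k f2 p.
Proof.
intros hp Hf.
assert (H := filter_imp _ _ (fun t Ht => Hf _ Ht) (locally_slice k p hp)).
destruct k; exact (Derive_ext_loc _ _ _ H).
Qed.

Lemma pdiff_ext (f1 f2 : R * R -> R) :
  (forall q, U q -> f1 q = f2 q) -> pdiff_on U f1 -> pdiff_on U f2.
Proof.
intros Hf H; apply is_pd_pdiff; intros k p hp; exists (pd k f1 p).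
now apply (is_pd_ext_on k f1 f2 p); auto.
Qed.

Lemma pdiff_plus (f1 f2 : R * R -> R) :
  pdiff_on U f1 -> pdiff_on U f2 -> pdiff_on U (fun q => f1 q + f2 q).
Proof.
intros H1 H2; apply is_pd_pdiff; intros k p hp; eexists.
now apply is_pd_plus; [apply H1 | apply H2].
Qed.

Lemma pdiff_minus (f1 f2 : R * R -> R) :
  pdiff_on U f1 -> pdiff_on U f2 -> pdiff_on U (fun q => f1 q - f2 q).
Proof.
intros H1 H2; apply is_pd_pdiff; intros k p hp; eexists.
now apply is_pd_minus; [apply H1 | apply H2].
Qed.

Lemma pdiff_mult (f1 f2 : R * R -> R) :
  pdiff_on U f1 -> pdiff_on U f2 -> pdiff_on U (fun q => f1 q * f2 q).
Proof.
intros H1 H2; apply is_pd_pdiff; intros k p hp; eexists.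
now apply is_pd_mult; [apply H1 | apply H2].
Qed.

Lemma pdiff_const (c : R) : pdiff_on U (fun _ => c).
Proof.
apply is_pd_pdiff; intros k p hp; eexists; apply is_pd_const.
Qed.

Lemma pdiff_div (f1 f2 : R * R -> R) :
  (forall q, U q -> f2 q <> 0) ->
  pdiff_on U f1 -> pdiff_on U f2 -> pdiff_on U (fun q => f1 q / f2 q).
Proof.
intros H0 H1 H2; apply is_pd_pdiff; intros k p hp; eexists.
now apply is_pd_div; [apply H0 | apply H1 | apply H2].
Qed.

Definition smooth (f : R * R -> R) : Prop :=
  forall (n : nat) (p : R * R), U p ->
    ex_diff_n (fun s t => f (s, t)) n (fst p) (snd p).

Lemma smooth_pdiff (f : R * R -> R) : smooth f -> pdiff_on U f.
Proof.
intros H k p hp; destruct (H 1%nat p hp) as (_ & H1 & H2 & _).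
destruct k; now apply Derive_correct.
Qed.

Lemma smooth_pd (k : index) (f : R * R -> R) : smooth f -> smooth (pd k f).
Proof.
intros H n p hp; destruct (H (S n) p hp) as (_ & _ & _ & H1 & H2).
now destruct k.
Qed.

(** The only nontrivial case is Schwarz's theorem, whose continuity hypotheses
    are the order-zero part of the smoothness of the second derivatives. *)
Lemma smooth_pd_comm (i j : index) (f : R * R -> R) (p : R * R) :
  smooth f -> U p -> pd i (pd j f) p = pd j (pd i f) p.
Proof.
intros H hp.
assert (HS : pd I1 (pd I2 f) p = pd I2 (pd I1 f) p).
{ assert (HC : forall k l, continuity_2d_pt
      (fun s t => pd k (pd l f) (s, t)) (fst p) (snd p)).
  { intros k l; exact (proj1 (smooth_pd k _ (smooth_pd l _ H) O p hp)). }
  apply (Schwarz (fun s t => f (s, t)) (fst p) (snd p)).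
  - destruct (hU p hp) as [e He]; exists e; intros u v Hu Hv.
    assert (huv : U (u, v)) by (apply He; destruct p; now split).
    pose proof (smooth_pdiff _ H) as H0.
    pose proof (smooth_pdiff _ (smooth_pd I1 _ H)) as H1.
    pose proof (smooth_pdiff _ (smooth_pd I2 _ H)) as H2.
    split; [|split; [|split]]; eexists.
    + exact (H0 I1 _ huv).
    + exact (H0 I2 _ huv).
    + exact (H2 I1 _ huv).
    + exact (H1 I2 _ huv).
  - exact (HC I1 I2).
  - exact (HC I2 I1). }
now destruct i, j.
Qed.

End PartialDerivatives.

(** * The frame of tangent vectors and Gauss map at a point *)

Lemma vec3_ext (v w : vec3) : (forall a, co a v = co a w) -> v = w.
Proof.
destruct v as [[v1 v2] v3], w as [[w1 w2] w3]; intros H.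
generalize (H C1) (H C2) (H C3); simpl; congruence.
Qed.

Lemma co_plus (a : coord) (v w : vec3) : co a (plus v w) = co a v + co a w.
Proof. now destruct a. Qed.

Lemma co_scal (a : coord) (c : R) (v : vec3) : co a (scal c v) = c * co a v.
Proof. now destruct a. Qed.

Lemma co_opp (a : coord) (v : vec3) : co a (opp v) = - co a v.
Proof. now destruct a. Qed.

Lemma co_vpd (a : coord) (k : index) (y : R * R -> vec3) (p : R * R) :
  co a (vpd k y p) = pd k (fun q => co a (y q)) p.
Proof. now destruct a. Qed.

(** If [X_12 = 0], the horizontal parts of [x_1] and [x_2] are dependent, so a
    nontrivial combination of [x_1] and [x_2] is vertical; it is nonzero by
    independence, and the tangent plane contains the vertical line through
    [x p]. *)
Lemma tangent_plane_isotropic (x : R * R -> vec3) (p : R * R) :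
  lin_indep2 (vpd I1 x p) (vpd I2 x p) -> X x C1 C2 p = 0 ->
  isotropic_plane (tangent_plane x p).
Proof.
intros Hind HX; unfold X in HX.
set (v := vpd I1 x p) in *; set (w := vpd I2 x p) in *.
assert (Hvert : exists a b : R, (a <> 0 \/ b <> 0) /\
  forall c, c <> C3 -> a * co c v + b * co c w = 0).
{ destruct (Req_dec (co C1 v) 0) as [H1 | H1].
  - destruct (Req_dec (co C2 v) 0) as [H2 | H2].
    + exists 1, 0; split; [left; lra | intros [ | | ] hc]; try rewrite H1;
        try rewrite H2; try ring; congruence.
    + exists (co C2 w), (- co C2 v); split; [right; lra |].
      intros [ | | ] hc; [lra | ring | congruence].
  - exists (co C1 w), (- co C1 v); split; [right; lra |].
    intros [ | | ] hc; [ring | lra | congruence]. }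
destruct Hvert as (a & b & Hab & Hvert).
assert (H3 : a * co C3 v + b * co C3 w <> 0).
{ intros H3.
  destruct (Hind a b) as [Ha Hb]; [| destruct Hab; contradiction].
  apply vec3_ext; intros c; rewrite co_plus, !co_scal.
  replace (co c zero) with 0 by now destruct c.
  destruct c; [apply Hvert; discriminate | apply Hvert; discriminate | exact H3]. }
exists (x p); intros t; set (m := a * co C3 v + b * co C3 w) in *.
(* [a v + b w] equals [m e_z], so [t / m] times it is [t e_z]. *)
exists (t / m * a), (t / m * b); fold v w.
apply vec3_ext; intros c; rewrite !co_plus, !co_scal; f_equal.
transitivity (t / m * (a * co c v + b * co c w)); [| ring].
destruct c.
- rewrite Hvert by discriminate; simpl; ring.
- rewrite Hvert by discriminate; simpl; ring.
- fold m; simpl; field; exact H3.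
Qed.

(** The covector [N = (xi^1, xi^2, 1)] applied to [v]; where [X_12]
    is nonzero it equals [det (x_1, x_2, v) / X_12]. *)
Definition conormal (x : R * R -> vec3) (p : R * R) (v : vec3) : R :=
  co C1 (xi x p) * co C1 v + co C2 (xi x p) * co C2 v + co C3 v.

(** Cramer's rule for [v = c_1 x_1 + c_2 x_2], read on the horizontal
    coordinates, where the determinant of the system is [X_12]. *)
Definition tangent_coord (x : R * R -> vec3) (p : R * R) (v : vec3)
  (k : index) : R :=
  match k with
  | I1 => (co C1 v * co C2 (vpd I2 x p) - co C2 v * co C1 (vpd I2 x p))
          / X x C1 C2 p
  | I2 => (co C1 (vpd I1 x p) * co C2 v - co C2 (vpd I1 x p) * co C1 v)
          / X x C1 C2 p
  end.

(** Explicit form of the coefficient [rho_ij] of [xi] in [x_ij]: apply [conormal]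
    to both sides of the defining relation. *)
Definition rho (x : R * R -> vec3) (i j : index) (p : R * R) : R :=
  conormal x p (vpd i (vpd j x) p) / xi_factor x p.

Lemma xi_factor_eq (x : R * R -> vec3) (p : R * R) :
  xi_factor x p = (1 + co C1 (xi x p) ^ 2 + co C2 (xi x p) ^ 2) / 2.
Proof.
unfold xi_factor.
assert (Hn : norm (xi_tilde x p) ^ 2
             = co C1 (xi x p) ^ 2 + co C2 (xi x p) ^ 2).
{ change (norm (xi_tilde x p)) with
    (sqrt (sqrt (Rabs (co C1 (xi x p)) ^ 2 + Rabs (co C2 (xi x p)) ^ 2) ^ 2
           + Rabs 0 ^ 2)).
  rewrite Rabs_R0, !pow2_abs, !pow2_sqrt; try ring;
    repeat first [apply Rplus_le_le_0_compat | apply pow2_ge_0]. }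
rewrite Hn.
change (co C3 (xi x p))
  with (1 / 2 * (1 - (co C1 (xi x p) ^ 2 + co C2 (xi x p) ^ 2))).
field.
Qed.

Lemma xi_factor_pos (x : R * R -> vec3) (p : R * R) : 0 < xi_factor x p.
Proof.
rewrite xi_factor_eq.
generalize (pow2_ge_0 (co C1 (xi x p))) (pow2_ge_0 (co C2 (xi x p))); lra.
Qed.

Lemma conormal_linear (x : R * R -> vec3) (p : R * R) (v v1 v2 v3 : vec3)
  (c1 c2 c3 : R) :
  (forall a, co a v = c1 * co a v1 + c2 * co a v2 + c3 * co a v3) ->
  conormal x p v
  = c1 * conormal x p v1 + c2 * conormal x p v2 + c3 * conormal x p v3.
Proof. intros H; unfold conormal; rewrite !H; ring. Qed.

Lemma conormal_xi (x : R * R -> vec3) (p : R * R) :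
  conormal x p (xi x p) = xi_factor x p.
Proof.
rewrite xi_factor_eq; unfold conormal.
change (co C3 (xi x p))
  with (1 / 2 * (1 - (co C1 (xi x p) ^ 2 + co C2 (xi x p) ^ 2))).
field.
Qed.

Section Frame.

Context (x : R * R -> vec3) (p : R * R) (hX : X x C1 C2 p <> 0).

Lemma conormal_tangent (i : index) : conormal x p (vpd i x p) = 0.
Proof.
destruct i; unfold conormal, xi; cbn [co fst snd]; field_simplify_eq; auto;
  unfold X, co; ring.
Qed.

(** The horizontal coordinates agree by Cramer's rule; both sides are annihilated
    by [conormal], which determines the third coordinate from the first two. *)
Lemma tangent_coord_spec (v : vec3) (a : coord) :
  conormal x p v = 0 ->
  co a v = tangent_coord x p v I1 * co a (vpd I1 x p)
           + tangent_coord x p v I2 * co a (vpd I2 x p).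
Proof.
intros Hv.
assert (Hplane : forall b, b <> C3 ->
  co b v = tangent_coord x p v I1 * co b (vpd I1 x p)
           + tangent_coord x p v I2 * co b (vpd I2 x p)).
{ intros b hb; unfold tangent_coord.
  destruct b; [ | | congruence]; field_simplify_eq; auto; unfold X; ring. }
destruct a; [apply Hplane; discriminate | apply Hplane; discriminate |].
generalize (conormal_tangent I1) (conormal_tangent I2); revert Hv.
unfold conormal.
rewrite (Hplane C1), (Hplane C2) by discriminate.
set (a1 := tangent_coord x p v I1); set (a2 := tangent_coord x p v I2).
intros Hv H1 H2.
apply (Rmult_eq_compat_l a1) in H1; apply (Rmult_eq_compat_l a2) in H2; lra.
Qed.

Lemma tangent_coord_unique (v : vec3) (c1 c2 : R) :
  (forall a, co a v = c1 * co a (vpd I1 x p) + c2 * co a (vpd I2 x p)) ->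
  c1 = tangent_coord x p v I1 /\ c2 = tangent_coord x p v I2.
Proof.
intros H; unfold tangent_coord; rewrite !H.
split; field_simplify_eq; auto; unfold X; ring.
Qed.

(** [conormal] isolates [c_3], because it kills [x_1] and [x_2] and takes the
    nonzero value [xi_factor] on [xi]; Cramer's rule then gives [c_1] and [c_2]
    from the tangential remainder. *)
Lemma frame_coords_unique (v : vec3) (c1 c2 c3 : R) :
  (forall a, co a v = c1 * co a (vpd I1 x p) + c2 * co a (vpd I2 x p)
                      + c3 * co a (xi x p)) ->
  c3 = conormal x p v / xi_factor x p
  /\ c1 = tangent_coord x p
       (minus v (scal (conormal x p v / xi_factor x p) (xi x p))) I1
  /\ c2 = tangent_coord x p
       (minus v (scal (conormal x p v / xi_factor x p) (xi x p))) I2.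
Proof.
intros H.
assert (H3 : c3 = conormal x p v / xi_factor x p).
{ rewrite (conormal_linear _ _ _ _ _ _ _ _ _ H), !conormal_tangent, conormal_xi.
  field; apply Rgt_not_eq, xi_factor_pos. }
split; [exact H3 |].
apply tangent_coord_unique; intros a; rewrite <- H3.
unfold minus; rewrite co_plus, co_opp, co_scal, H; ring.
Qed.

Lemma frame_coords_spec (v : vec3) (a : coord) :
  co a v
  = tangent_coord x p
      (minus v (scal (conormal x p v / xi_factor x p) (xi x p))) I1
      * co a (vpd I1 x p)
    + tangent_coord x p
        (minus v (scal (conormal x p v / xi_factor x p) (xi x p))) I2
      * co a (vpd I2 x p)
    + conormal x p v / xi_factor x p * co a (xi x p).
Proof.
set (c3 := conormal x p v / xi_factor x p); set (w := minus v (scal c3 (xi x p))).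
assert (Hw : forall b, co b w = 1 * co b v + (- c3) * co b (xi x p)
                                + 0 * co b (xi x p)).
{ intros b; unfold w, minus; rewrite co_plus, co_opp, co_scal; ring. }
rewrite <- tangent_coord_spec, Hw; [ring |].
rewrite (conormal_linear _ _ _ _ _ _ _ _ _ Hw), conormal_xi; unfold c3; field.
apply Rgt_not_eq, xi_factor_pos.
Qed.

Lemma frame_free (c1 c2 c3 : R) :
  (forall a, c1 * co a (vpd I1 x p) + c2 * co a (vpd I2 x p)
             + c3 * co a (xi x p) = 0) ->
  c1 = 0 /\ c2 = 0.
Proof.
intros H.
assert (H0 : forall a, co a zero = 0) by now destruct a.
destruct (frame_coords_unique zero c1 c2 c3) as (_ & -> & ->).
{ intros a; now rewrite H0, H. }
destruct (frame_coords_unique zero 0 0 0) as (_ & <- & <-); [| easy].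
intros a; rewrite H0; ring.
Qed.

(** The epsilon term is specified by an existing decomposition, and the
    decomposition is unique. *)
Lemma tangent_coeff_eq (v : vec3) (k : index) :
  conormal x p v = 0 -> tangent_coeff x p v k = tangent_coord x p v k.
Proof.
intros Hv; unfold tangent_coeff, tangent_coeffs.
match goal with |- context [epsilon ?i ?P] =>
  assert (HP : P (epsilon i P)); [apply epsilon_spec |
    set (c := epsilon i P) in *; clearbody c] end.
- exists (tangent_coord x p v I1, tangent_coord x p v I2).
  apply vec3_ext; intros a; cbn [fst snd]; rewrite co_plus, !co_scal.
  now apply tangent_coord_spec.
- destruct (tangent_coord_unique v (fst c) (snd c)) as [H1 H2].
  + intros a; rewrite HP at 1; now rewrite co_plus, !co_scal.
  + now destruct k.
Qed.

Lemma Xi_eq (i j k : index) :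
  Xi x i j k p
  = tangent_coord x p (minus (vpd i (vpd j x) p) (scal (rho x i j p) (xi x p))) k.
Proof.
unfold Xi, frame_coeffs, rho; set (v := vpd i (vpd j x) p).
match goal with |- context [epsilon ?i ?P] =>
  assert (HP : P (epsilon i P)); [apply epsilon_spec |
    set (c := epsilon i P) in *; clearbody c] end.
- eexists (_, _, _).
  apply vec3_ext; intros a; cbn [fst snd]; rewrite !co_plus, !co_scal.
  apply frame_coords_spec.
- destruct (frame_coords_unique v (fst (fst c)) (snd (fst c)) (snd c))
    as (_ & H1 & H2).
  + intros a; rewrite HP at 1; now rewrite !co_plus, !co_scal.
  + now destruct k.
Qed.

Lemma gauss_formula (i j : index) (a : coord) :
  co a (vpd i (vpd j x) p)
  = Xi x i j I1 p * co a (vpd I1 x p) + Xi x i j I2 p * co a (vpd I2 x p)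
    + rho x i j p * co a (xi x p).
Proof. rewrite !Xi_eq; unfold rho; apply frame_coords_spec. Qed.

(** The definition expresses [x_i] through the chosen tangent coordinates of
    [x_i]; these are the expected [(1, 0)] and [(0, 1)]. *)
Lemma shape_operator_tangent (i : index) (a : coord) :
  co a (shape_operator x p (vpd i x p)) = - co a (vpd i (xi x) p).
Proof.
unfold shape_operator; rewrite !tangent_coeff_eq by apply conormal_tangent.
rewrite co_plus, !co_scal, !co_opp.
destruct i.
- destruct (tangent_coord_unique (vpd I1 x p) 1 0) as [<- <-]; intros; ring.
- destruct (tangent_coord_unique (vpd I2 x p) 0 1) as [<- <-]; intros; ring.
Qed.

End Frame.

(** * The structure equations on the surface *)

Section Surface.

Context (U : R * R -> Prop) (x : R * R -> vec3).
Context (hx : local_parameterization U x) (hadm : admissible U x).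

Lemma X12_neq0 (p : R * R) : U p -> X x C1 C2 p <> 0.
Proof.
intros hp HX; destruct hx as (_ & _ & Hind).
exact (hadm p hp (tangent_plane_isotropic x p (Hind p hp) HX)).
Qed.

Lemma smooth_coord (a : coord) : smooth U (fun q => co a (x q)).
Proof. intros n p hp; destruct hx as (_ & H & _); exact (H a n p hp). Qed.

Lemma smooth_vpd (a : coord) (i : index) : smooth U (fun q => co a (vpd i x q)).
Proof.
generalize (smooth_pd U i _ (smooth_coord a)); now destruct a.
Qed.

Lemma smooth_vpd2 (a : coord) (i j : index) :
  smooth U (fun q => co a (vpd i (vpd j x) q)).
Proof.
generalize (smooth_pd U i _ (smooth_vpd a j)); now destruct a.
Qed.

Lemma vpd2_sym (i j : index) (p : R * R) :
  U p -> vpd i (vpd j x) p = vpd j (vpd i x) p.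
Proof.
intros hp; apply vec3_ext; intros a; rewrite !co_vpd.
transitivity (pd i (pd j (fun q => co a (x q))) p); [now destruct a |].
rewrite (smooth_pd_comm U (proj1 hx)); auto using smooth_coord; now destruct a.
Qed.

(** The index pair [(j, k)] is exchanged by passing through [x_ji]: only then do
    the derivatives in [u^j] and [u^k] become adjacent. *)
Lemma vpd3_sym (i j k : index) (a : coord) (p : R * R) :
  U p -> pd k (fun q => co a (vpd i (vpd j x) q)) p
         = pd j (fun q => co a (vpd i (vpd k x) q)) p.
Proof.
intros hp.
assert (Hout : forall m, pd m (fun q => co a (vpd i (vpd j x) q)) p
          = pd m (fun q => co a (vpd j (vpd i x) q)) p).
{ intros m; apply (pd_ext_on U (proj1 hx)); auto; intros q hq.
  now rewrite vpd2_sym. }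
rewrite Hout.
transitivity (pd k (pd j (fun q => co a (vpd i x q))) p); [now destruct a |].
rewrite (smooth_pd_comm U (proj1 hx)); auto using smooth_vpd.
transitivity (pd j (fun q => co a (vpd k (vpd i x) q)) p); [now destruct a |].
apply (pd_ext_on U (proj1 hx)); auto; intros q hq; now rewrite vpd2_sym.
Qed.

Lemma Xi_sym (i j k : index) (p : R * R) : U p -> Xi x i j k p = Xi x j i k p.
Proof. intros hp; unfold Xi; now rewrite vpd2_sym. Qed.

Lemma pdiff_vpd (a : coord) (i : index) :
  pdiff_on U (fun q => co a (vpd i x q)).
Proof. apply smooth_pdiff, smooth_vpd. Qed.

Lemma pdiff_X (a b : coord) : pdiff_on U (X x a b).
Proof.
apply pdiff_minus; apply pdiff_mult; apply pdiff_vpd.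
Qed.

Lemma pdiff_xi (a : coord) : pdiff_on U (fun q => co a (xi x q)).
Proof.
assert (HX : forall b c, pdiff_on U (fun q => X x b c q / X x C1 C2 q)).
{ intros b c; apply pdiff_div; auto using X12_neq0, pdiff_X. }
destruct a; [apply HX | apply HX |].
apply pdiff_mult; [apply pdiff_const |].
apply pdiff_minus; [apply pdiff_const |].
assert (HX1 : forall b c,
          pdiff_on U (fun q => (X x b c q / X x C1 C2 q) ^ 2)).
{ intros b c; apply pdiff_mult; [apply HX |].
  apply pdiff_mult; [apply HX | apply pdiff_const]. }
apply pdiff_plus; apply HX1.
Qed.

Lemma pdiff_rho (i j : index) : pdiff_on U (rho x i j).
Proof.
assert (H2 : forall a, pdiff_on U (fun q => co a (vpd i (vpd j x) q)))
  by (intros a; apply smooth_pdiff, smooth_vpd2).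
assert (Hxi := pdiff_xi).
apply pdiff_div.
- intros q _; apply Rgt_not_eq, xi_factor_pos.
- apply pdiff_plus; [apply pdiff_plus; apply pdiff_mult |]; auto.
- apply (pdiff_ext U (proj1 hx) (fun q => (1 + co C1 (xi x q) * co C1 (xi x q)
                                     + co C2 (xi x q) * co C2 (xi x q)) / 2)).
  + intros q _; rewrite xi_factor_eq; field.
  + apply pdiff_div; [intros; lra | | apply pdiff_const].
    apply pdiff_plus; [apply pdiff_plus; [apply pdiff_const |] |];
      apply pdiff_mult; auto.
Qed.

Lemma pdiff_Xi (i j k : index) : pdiff_on U (Xi x i j k).
Proof.
apply (pdiff_ext U (proj1 hx) (fun q => tangent_coord x q
  (minus (vpd i (vpd j x) q) (scal (rho x i j q) (xi x q))) k)).
- intros q hq; now rewrite Xi_eq by now apply X12_neq0.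
- assert (Hw : forall a, pdiff_on U (fun q =>
      co a (minus (vpd i (vpd j x) q) (scal (rho x i j q) (xi x q))))).
  { intros a; apply (pdiff_ext U (proj1 hx) (fun q =>
      co a (vpd i (vpd j x) q) - rho x i j q * co a (xi x q))).
    - intros q _; unfold minus; rewrite co_plus, co_opp, co_scal; ring.
    - apply pdiff_minus; [apply smooth_pdiff, smooth_vpd2 |].
      apply pdiff_mult; [apply pdiff_rho | apply pdiff_xi]. }
  destruct k; (apply pdiff_div; [apply X12_neq0 | | apply pdiff_X]);
    apply pdiff_minus; apply pdiff_mult; auto using pdiff_vpd.
Qed.

(** The Gauss map takes values in the paraboloid
    [z = (1 - x^2 - y^2) / 2], whose tangent plane at [xi] is the kernel of the
    covector [(xi^1, xi^2, 1)]. *)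
Lemma conormal_vpd_xi (k : index) (p : R * R) :
  U p -> conormal x p (vpd k (xi x) p) = 0.
Proof.
intros hp; unfold conormal; rewrite !co_vpd.
assert (H3 : pd k (fun q => co C3 (xi x q)) p
  = 0 * (1 - (co C1 (xi x p) * co C1 (xi x p) + co C2 (xi x p) * co C2 (xi x p)))
    + 1 / 2 * (0 - ((pd k (fun q => co C1 (xi x q)) p * co C1 (xi x p)
                     + co C1 (xi x p) * pd k (fun q => co C1 (xi x q)) p)
                    + (pd k (fun q => co C2 (xi x q)) p * co C2 (xi x p)
                       + co C2 (xi x p) * pd k (fun q => co C2 (xi x q)) p)))).
{ apply is_pd_unique.
  apply (is_pd_ext_on U (proj1 hx) k (fun q => 1 / 2 * (1 -
    (co C1 (xi x q) * co C1 (xi x q) + co C2 (xi x q) * co C2 (xi x q)))));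
    [exact hp | intros q _; unfold xi; simpl; ring |].
  apply (is_pd_mult k (fun _ => 1 / 2)); [apply is_pd_const |].
  apply (is_pd_minus k (fun _ => 1)); [apply is_pd_const |].
  apply is_pd_plus; apply is_pd_mult; now apply pdiff_xi. }
rewrite H3; field.
Qed.

(** Differentiate [N(x_j) = 0] in [u^i]; the constant third entry of [N] makes
    the derivative of [N] pair with [x_j] by the degenerate product. *)
Lemma weingarten_inner (i j : index) (p : R * R) :
  U p -> inner_z (vpd i (xi x) p) (vpd j x p)
         = - conormal x p (vpd i (vpd j x) p).
Proof.
intros hp.
assert (H : 0 =
  (pd i (fun q => co C1 (xi x q)) p * co C1 (vpd j x p)
   + co C1 (xi x p) * pd i (fun q => co C1 (vpd j x q)) p)
  + (pd i (fun q => co C2 (xi x q)) p * co C2 (vpd j x p)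
     + co C2 (xi x p) * pd i (fun q => co C2 (vpd j x q)) p)
  + pd i (fun q => co C3 (vpd j x q)) p).
{ rewrite <- (is_pd_unique i (fun _ => 0) p 0 (is_pd_const i 0 p)).
  apply is_pd_unique.
  apply (is_pd_ext_on U (proj1 hx) i (fun q => conormal x q (vpd j x q)));
    [exact hp | intros q hq; now apply conormal_tangent, X12_neq0 |].
  apply is_pd_plus; [| now apply pdiff_vpd].
  apply is_pd_plus; (apply is_pd_mult; [now apply pdiff_xi | now apply pdiff_vpd]). }
unfold inner_z, conormal; rewrite !(co_vpd _ i); lra.
Qed.

Lemma weingarten_formula (i : index) (a : coord) (p : R * R) :
  U p -> co a (vpd i (xi x) p)
         = - (L_matrix x i I1 p * co a (vpd I1 x p)
              + L_matrix x i I2 p * co a (vpd I2 x p)).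
Proof.
intros hp; assert (hX := X12_neq0 p hp); unfold L_matrix.
set (w := shape_operator x p (vpd i x p)).
assert (Hw : forall b, co b w = (-1) * co b (vpd i (xi x) p)
               + 0 * co b (xi x p) + 0 * co b (xi x p)).
{ intros b; unfold w; rewrite shape_operator_tangent by exact hX; ring. }
assert (Hw0 : conormal x p w = 0).
{ rewrite (conormal_linear _ _ _ _ _ _ _ _ _ Hw), conormal_vpd_xi by exact hp.
  ring. }
rewrite !tangent_coeff_eq by assumption.
rewrite <- tangent_coord_spec, Hw by assumption; ring.
Qed.

Lemma h_eq_L (i j : index) (p : R * R) :
  U p -> h x i j p = L_matrix x i I1 p * g x I1 j p
                     + L_matrix x i I2 p * g x I2 j p.
Proof.
intros hp; unfold h, g, inner_z.
rewrite !shape_operator_tangent, !weingarten_formula by auto using X12_neq0; ring.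
Qed.

Lemma h_eq_rho (i j : index) (p : R * R) :
  U p -> h x i j p = xi_factor x p * rho x i j p.
Proof.
intros hp; unfold rho.
transitivity (- inner_z (vpd i (xi x) p) (vpd j x p)).
- unfold h, inner_z; rewrite !shape_operator_tangent by auto using X12_neq0; ring.
- rewrite weingarten_inner by exact hp; field.
  apply Rgt_not_eq, xi_factor_pos.
Qed.

Lemma h_sym (i j : index) (p : R * R) : U p -> h x i j p = h x j i p.
Proof.
intros hp; rewrite !h_eq_rho by exact hp; unfold rho; now rewrite vpd2_sym.
Qed.

(** The derivative of the Gauss formula, with the derivatives of the frame left
    unexpanded. *)
Lemma pd_vpd2 (i j k : index) (a : coord) (p : R * R) :
  U p -> pd k (fun q => co a (vpd i (vpd j x) q)) p
  = sum2 (fun l => pd k (Xi x i j l) p * co a (vpd l x p)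
                   + Xi x i j l p * co a (vpd k (vpd l x) p))
    + (pd k (rho x i j) p * co a (xi x p)
       + rho x i j p * co a (vpd k (xi x) p)).
Proof.
intros hp; apply is_pd_unique.
apply (is_pd_ext_on U (proj1 hx) k (fun q =>
  Xi x i j I1 q * co a (vpd I1 x q) + Xi x i j I2 q * co a (vpd I2 x q)
  + rho x i j q * co a (xi x q))); [exact hp | |].
- intros q hq; now rewrite gauss_formula by now apply X12_neq0.
- unfold sum2; rewrite !(co_vpd _ k).
  apply is_pd_plus; [apply is_pd_plus |]; apply is_pd_mult.
  + now apply pdiff_Xi.
  + now apply pdiff_vpd.
  + now apply pdiff_Xi.
  + now apply pdiff_vpd.
  + now apply pdiff_rho.
  + now apply pdiff_xi.
Qed.

(** The derivatives of [x_ij] in [u^k] and of [x_ik] in [u^j] coincide.  Expanded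
    in the frame, their difference has the quantities [D l] below as tangential
    coefficients, so these vanish. *)
Lemma gauss_equation (l i j k : index) (p : R * R) :
  U p -> Riem x l i j k p
  = rho x i j p * L_matrix x k l p - rho x i k p * L_matrix x j l p.
Proof.
intros hp.
set (D l := Riem x l i j k p
  - (rho x i j p * L_matrix x k l p - rho x i k p * L_matrix x j l p)).
enough (H : D I1 = 0 /\ D I2 = 0)
  by (unfold D in H; destruct H, l; apply Rminus_diag_uniq; assumption).
(* The coefficient of [xi] is the Codazzi expression. *)
apply (frame_free x p (X12_neq0 p hp) _ _
  (pd k (rho x i j) p - pd j (rho x i k) p
   + sum2 (fun s => Xi x i j s p * rho x k s p)
   - sum2 (fun s => Xi x i k s p * rho x j s p))).
intros a.
assert (H := vpd3_sym i j k a p hp).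
rewrite !pd_vpd2 in H by exact hp.
unfold sum2 in H.
rewrite !gauss_formula, !weingarten_formula in H by auto using X12_neq0.
apply Rminus_diag_eq in H; rewrite <- H.
unfold D, Riem, sum2; ring.
Qed.

Lemma metric_det (p : R * R) :
  g x I1 I1 p * g x I2 I2 p - g x I1 I2 p ^ 2 = X x C1 C2 p ^ 2.
Proof. unfold g, inner_z, X; ring. Qed.

Lemma g11_neq0 (p : R * R) : U p -> g x I1 I1 p <> 0.
Proof.
intros hp H.
destruct (Rplus_sqr_eq_0 _ _ H) as [H1 H2].
apply (X12_neq0 p hp); unfold X; rewrite H1, H2; ring.
Qed.

End Surface.

(** * The curvature tensor and the Gaussian curvature *)

Theorem mainTheorem9 (U : R * R -> Prop) (x : R * R -> vec3)
  (hx : local_parameterization U x) (hadm : admissible U x)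
  (p : R * R) (hp : U p) :
  (forall d a b c : index,
     Riem_low x d a b c p
     = (h x a b p * h x c d p - h x a c p * h x b d p) / xi_factor x p)
  /\ K x p
     = xi_factor x p
       * (Riem_low x I2 I1 I1 I2 p
          / (g x I1 I1 p * g x I2 I2 p - (g x I1 I2 p) ^ 2))
  /\ K x p
     = xi_factor x p / g x I1 I1 p
       * (pd I2 (Xi x I1 I1 I2) p - pd I1 (Xi x I1 I2 I2) p
          + sum2 (fun l => Xi x I1 I1 l p * Xi x l I2 I2 p)
          - sum2 (fun l => Xi x I1 I2 l p * Xi x l I1 I2 p)).
Proof.
assert (hF := Rgt_not_eq _ _ (xi_factor_pos x p)).
assert (hg := g11_neq0 U x hx hadm p hp).
assert (hX := X12_neq0 U x hx hadm p hp).
assert (hgs : g x I2 I1 p = g x I1 I2 p) by (unfold g, inner_z; ring).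
assert (HR : forall d a b c : index, Riem_low x d a b c p
  = (h x a b p * h x c d p - h x a c p * h x b d p) / xi_factor x p).
{ intros d a b c; unfold Riem_low, sum2.
  rewrite !(gauss_equation U x hx hadm) by exact hp.
  rewrite (h_eq_L U x hx hadm c d), (h_eq_L U x hx hadm b d) by exact hp.
  rewrite !(h_eq_rho U x hx hadm) by exact hp; field; exact hF. }
assert (h12 := h_sym U x hx hadm I1 I2 p hp).
split; [exact HR | split].
- rewrite HR, metric_det.
  (* This quotient is [det h / det g], and [h = L g] makes it [det L]. *)
  transitivity ((h x I1 I1 p * h x I2 I2 p - h x I1 I2 p * h x I2 I1 p)
                / X x C1 C2 p ^ 2); [| rewrite h12; field; now split].
  rewrite !(h_eq_L U x hx hadm), hgs by exact hp.
  apply (Rmult_eq_reg_r (X x C1 C2 p ^ 2)); [| now apply pow_nonzero].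
  unfold Rdiv; rewrite Rmult_assoc, Rinv_l by now apply pow_nonzero.
  rewrite <- metric_det; unfold K; ring.
- assert (HG := gauss_equation U x hx hadm I2 I1 I1 I2 p hp).
  unfold Riem, sum2 in HG; unfold sum2.
  rewrite (Xi_sym U x hx I2 I1 I2 p hp) in *.
  rewrite HG; clear HG.
  (* With [h_21] in place of [h_12], expanding [h = L g] cancels every [g_12]
     and leaves [g_11 det L]. *)
  transitivity ((h x I1 I1 p * L_matrix x I2 I2 p
                 - h x I2 I1 p * L_matrix x I1 I2 p) / g x I1 I1 p).
  + rewrite !(h_eq_L U x hx hadm) by exact hp; unfold K; field; exact hg.
  + rewrite <- h12, !(h_eq_rho U x hx hadm) by exact hp; field; exact hg.
Qed.
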